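(* Let $S$ be a standard graded Noetherian algebra over a commutative ring $R$ and let $M$ be a graded $S$-module. Then $$\bigcup_{\mu\in\mathbf{Z}}\operatorname{Ass}_R(M_\mu)=\{\mathfrak{P}\cap R\mid\mathfrak{P}\in\operatorname{Ass}_S(M)\}.$$
   Context: $S=\bigoplus_{\mu\ge0}S_\mu$ is a Noetherian graded ring with $S_0=R$, generated as an $R$-algebra by $S_1$. Graded modules are $\mathbf{Z}$-graded and not assumed finitely generated; $M_\mu$ is the degree $\mu$ component, an $R$-module. $\operatorname{Ass}$ denotes the set of associated primes (primes that are annihilators of an element of the module). *)

(* Defs.v *)
From HB Require Import structures.
From mathcomp Require Import all_boot all_order all_algebra.
From mathcomp Require Import mathcomp_extra boolp classical_sets functions.
From mathcomp Require Import cardinality fsbigop.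

Set Implicit Arguments.
Unset Strict Implicit.
Unset Printing Implicit Defensive.

Import GRing.Theory.
Local Open Scope classical_set_scope.
Local Open Scope ring_scope.

(* All rings are [comPzRingType]s, so that the zero ring is allowed. The ideals
   of ring_quotient are proper ideals of non-zero rings, hence the definitions
   below. *)

Definition ideal (R : comPzRingType) (I : set R) : Prop :=
  submod_closed (mem I : {pred R^o}).

Definition prime_ideal (R : comPzRingType) (P : set R) : Prop :=
  [/\ ideal P, ~ P 1 & forall u v, P (u * v) -> P u \/ P v].

Definition ideal_generated (R : comPzRingType) (n : nat) (a : 'I_n -> R) :
    set R :=
  [set x | exists c : 'I_n -> R, x = \sum_(i < n) c i * a i].

Definition noetherian (R : comPzRingType) : Prop :=
  forall I : set R, ideal I ->
  exists (n : nat) (a : 'I_n -> R), I = ideal_generated a.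

Definition annihilator (R : comPzRingType) (V : lmodType R) (x : V) : set R :=
  [set r | r *: x = 0].

(* Associated primes of a submodule N of V, seen as an R-module in its own
   right; Ass_R(V) itself is [Ass [set: V]]. *)
Definition Ass (R : comPzRingType) (V : lmodType R) (N : set V) :
    set (set R) :=
  [set P | prime_ideal P /\ exists2 x, N x & P = annihilator x].

(* The R-module structure on an S-module M obtained from a ring morphism
   R -> S. *)
Definition restrict_scalars (R S : comPzRingType) (iota : {rmorphism R -> S})
  (M : lmodType S) : Type := M.

Section RestrictScalars.
Variables (R S : comPzRingType) (iota : {rmorphism R -> S}) (M : lmodType S).

HB.instance Definition _ :=
  GRing.Zmodule.copy (restrict_scalars iota M) (M : Type).

Let scale (r : R) (x : restrict_scalars iota M) : restrict_scalars iota M :=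
  iota r *: (x : M).

Fact restrict_scalars_scalerA r s x : scale r (scale s x) = scale (r * s) x.
Proof. by rewrite /scale scalerA rmorphM. Qed.

Fact restrict_scalars_scale1r : left_id 1 scale.
Proof. by move=> x; rewrite /scale rmorph1 scale1r. Qed.

Fact restrict_scalars_scalerDr : right_distributive scale +%R.
Proof. by move=> r x y; rewrite /scale scalerDr. Qed.

Fact restrict_scalars_scalerDl x : {morph scale^~ x : r s / r + s}.
Proof. by move=> r s; rewrite /scale rmorphD scalerDl. Qed.

HB.instance Definition _ :=
  GRing.Zmodule_isLmodule.Build R (restrict_scalars iota M)
    restrict_scalars_scalerA restrict_scalars_scale1r
    restrict_scalars_scalerDr restrict_scalars_scalerDl.

End RestrictScalars.

(* Finiteness of the support is required separately because a [\sum_(i \in A)]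
   with infinite support is 0 by convention. *)
Definition internal_direct_sum (I : choiceType) (V : zmodType)
    (V_ : I -> set V) : Prop :=
  (forall i, zmod_closed (mem (V_ i))) /\
  (forall v : V, exists! f : I -> V,
    [/\ forall i, V_ i (f i), finite_set [set i | f i != 0]
      & v = \sum_(i \in [set: I]) f i]).

Definition generated_as_algebra (R S : comPzRingType)
    (iota : {rmorphism R -> S}) (X : set S) : Prop :=
  forall A : set S, subring_closed (mem A) ->
    range iota `<=` A -> X `<=` A -> A = [set: S].

(* The identification of R with the degree 0 component is the injection iota,
   so an ideal P of S meets R in [iota @^-1` P]. *)
Record standard_graded (R S : comPzRingType) (iota : {rmorphism R -> S})
    (S_ : nat -> set S) : Prop := StandardGraded {
  standard_graded_sum : internal_direct_sum S_;
  standard_graded_mul :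
    forall i j s t, S_ i s -> S_ j t -> S_ (i + j)%N (s * t);
  standard_graded_inj : injective iota;
  standard_graded0 : S_ 0%N = range iota;
  standard_graded_gen : generated_as_algebra iota (S_ 1%N)
}.

Record graded_module (S : comPzRingType) (S_ : nat -> set S)
    (M : lmodType S) (M_ : int -> set M) : Prop := GradedModule {
  graded_module_sum : internal_direct_sum M_;
  graded_module_scale :
    forall i mu s x, S_ i s -> M_ mu x -> M_ (i%:Z + mu) (s *: x)
}.

(* Main.v *)
Require Import Defs.
From mathcomp Require Import all_boot all_order all_algebra.
From mathcomp Require Import classical_sets.
From mathcomp Require Import boolp cardinality fsbigop.

(** Why the two sets of primes agree.

    Every prime [p] of [R] associated to [M], regarded as an [R]-module, is
    contracted from [Ass M] ([Ass_restrict_scalars_lift]).  If [p] is the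
    annihilator of [x] in [R], the elements [s] of [S] such that [s *: x] is
    killed by some element outside [p] form an ideal.  It is finitely
    generated, so a single [r0] outside [p] does all the killing.  On the
    submodule generated by [r0 *: x] the elements outside
    [p] then act injectively, as they would after localizing at [p], so every
    nonzero element there has an annihilator contracting to [p].  As [S] is
    Noetherian, one of these annihilators is prime
    ([exists_prime_annihilator]).

    Conversely, let [P] be the annihilator of [x] in [S], and decompose [x]
    into its homogeneous components.  Since [R] acts in degree 0, the prime
    [p = iota @^-1` P] is the intersection of the annihilators in [R] of the
    finitely many nonzero components.  A prime that is a finite intersection
    of ideals equals one of them, hence [p] is the annihilator of a
    homogeneous element ([Ass_direct_sum]). *)

Set Implicit Arguments.
Unset Strict Implicit.

Local Open Scope classical_set_scope.
Local Open Scope ring_scope.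

Import GRing.Theory.

Lemma idealP (R : comPzRingType) (I : set R) :
  ideal I <-> I 0 /\ forall a u v, I u -> I v -> I (a * u + v).
Proof.
split=> [[I0 Ilin]|[I0 Ilin]].
  split=> [|a u v Iu Iv]; first exact: set_mem I0.
  by apply: set_mem; apply: Ilin; apply: mem_set.
split=> [|a u v Iu Iv]; first exact: mem_set.
by apply: mem_set; apply: Ilin; apply: set_mem.
Qed.

Lemma annihilator_ideal (R : comPzRingType) (V : lmodType R) (x : V) :
  ideal (annihilator x).
Proof.
apply/idealP; split=> [|a u v]; rewrite /annihilator /= ?scale0r // => u0 v0.
by rewrite scalerDl -scalerA u0 v0 scaler0 addr0.
Qed.

Lemma ideal_generated_gen (R : comPzRingType) (n : nat) (a : 'I_n -> R) i :
  ideal_generated a (a i).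
Proof.
exists (fun j => (j == i)%:R); rewrite (bigD1 i) //= eqxx mul1r big1 ?addr0 //.
by move=> j /negPf ->; rewrite mul0r.
Qed.

(** What makes the union of a chain of ideals, once finitely generated, equal
    to a member of the chain. *)
Lemma chain_absorbs_finite (T : Type) (C : set (set T)) (n : nat)
    (a : 'I_n -> T) :
  C !=set0 -> total_on C subset -> (forall i, (\bigcup_(X in C) X) (a i)) ->
  exists2 X, C X & forall i, X (a i).
Proof.
move=> [X0 CX0] Ctot; elim: n a => [|n IHn] a aC; first by exists X0 => // - [].
have [X CX Xa] := IHn (fun i => a (lift ord0 i)) (fun i => aC _).
have [Y CY Ya] := aC ord0.
have [sXY|sYX] := Ctot _ _ CX CY; [exists Y | exists X] => // i;
  by case: (unliftP ord0 i) => [j|] ->; auto.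
Qed.

(** By Zorn's lemma: the union of a chain in [F] is an ideal, and its finitely
    many generators already lie in one member of the chain. *)
Lemma noetherian_maximal (R : comPzRingType) (F : set (set R)) :
    noetherian R -> F !=set0 -> F `<=` @ideal R ->
  exists2 I, F I & forall J, F J -> I `<=` J -> J `<=` I.
Proof.
move=> noethR [I0 FI0] idF.
(* [set0] is adjoined to [F] to give the empty chain an upper bound. *)
have [C CF Ctot|I [FI Imax]] := @Zorn_bigcup R (F `|` [set set0]).
  have [->|/set0P[x0 [X0 CX0 X0x]]] := eqVneq (\bigcup_(X in C) X) set0.
    by right.
  have idC X x : C X -> X x -> F X by move=> /CF[//|->].
  have idU : ideal (\bigcup_(X in C) X).
    apply/idealP; split=> [|a u v [X CX Xu] [Y CY Yv]].
      by exists X0 => //; have /idF/idealP[] := idC _ _ CX0 X0x.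
    have /idF/idealP[_ linX] := idC _ _ CX Xu.
    have /idF/idealP[_ linY] := idC _ _ CY Yv.
    by have [sXY|sYX] := Ctot _ _ CX CY; [exists Y | exists X]; auto.
  have [n [a Ua]] := noethR _ idU.
  have aU i : (\bigcup_(X in C) X) (a i) by rewrite Ua; exact: ideal_generated_gen.
  have [|X CX Xa] := chain_absorbs_finite _ Ctot aU; first by exists X0.
  (* [X] is empty if it is [set0] and there are no generators; enlarging it to
     contain [x0] puts it in [F]. *)
  have [Y [CY Yx0 Ya]] : exists Y, [/\ C Y, Y x0 & forall i, Y (a i)].
    by have [sXX0|sX0X] := Ctot _ _ CX CX0; [exists X0 | exists X]; split; auto.
  suff <- : Y = \bigcup_(X in C) X by exact: CF.
  apply/seteqP; split=> [z Yz|z]; first by exists Y.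
  have /idF/idealP[Y0 Ylin] := idC _ _ CY Yx0.
  rewrite Ua => -[c ->]; elim/big_ind: _ => // [u v Yu Yv|i _].
    by rewrite -[u]mul1r; exact: Ylin.
  by rewrite -[_ * _]addr0; exact: Ylin.
have FI' : F I.
  case: FI => // I_0; case: (Imax I0); last by left.
  rewrite I_0; split=> [z []|/(_ 0)]; apply.
  by have /idF/idealP[] := FI0.
exists I => // J FJ sIJ; apply: contrapT => nsJI.
by apply: (Imax J); [split | left].
Qed.

Lemma prime_ideal_prod (R : comPzRingType) (P : set R) (J : Type) (r : seq J)
    (c : J -> R) :
  prime_ideal P -> (forall j, ~ P (c j)) -> ~ P (\prod_(j <- r) c j).
Proof.
move=> [_ P1 Pmul] cP; elim/big_ind: _ => // u v Pu Pv /Pmul[]//.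
Qed.

(** An annihilator that is maximal among those of the nonzero multiples [y] of
    [x] is prime: if [u * v] kills [y] but [u] does not, then [u *: y] is
    another nonzero multiple, its annihilator contains that of [y] and hence
    equals it, and it contains [v]. *)
Lemma exists_prime_annihilator (S : comPzRingType) (M : lmodType S) (x : M) :
  noetherian S -> x <> 0 -> exists s, prime_ideal (annihilator (s *: x)).
Proof.
move=> noethS x0.
pose F := [set annihilator (s *: x) | s in [set s | s *: x <> 0]].
have [| |_ [s /= sx0 <-] smax] := @noetherian_maximal S F noethS.
- by exists (annihilator (1 *: x)); exists 1 => //=; rewrite scale1r.
- by move=> _ [s _ <-]; exact: annihilator_ideal.
exists s; split=> [||u v /= uvsx0]; first exact: annihilator_ideal.
  by rewrite /annihilator /= scale1r.
have [usx0|usx0] := pselect (u *: (s *: x) = 0); [by left | right].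
apply: (smax (annihilator ((u * s) *: x))).
- by exists (u * s) => //=; rewrite -scalerA.
- move=> t tsx0; rewrite /annihilator /= scalerA mulrCA -scalerA -scalerA.
  by rewrite tsx0 scaler0.
- by rewrite /annihilator /= scalerA mulrA [v * u]mulrC -scalerA.
Qed.

(** Replacing [x] by [r0 *: x], with [r0] outside [p] killing all the torsion
    of [S x] with respect to the complement of [p], plays the part of
    localization at [p]: every nonzero multiple of [r0 *: x] has an annihilator
    contracting to [p]. *)
Lemma Ass_restrict_scalars_lift (R S : comPzRingType)
    (iota : {rmorphism R -> S}) (M : lmodType S) (p : set R) :
    noetherian S -> Ass [set: restrict_scalars iota M] p ->
  [set iota @^-1` P | P in Ass [set: M]] p.
Proof.
move=> noethS [p_prime [x _ def_p]]; have [p_ideal p1 pM] := p_prime.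
have pE r : p r <-> iota r *: (x : M) = 0 by rewrite def_p.
(* The multipliers of [x] into the kernel of localization at [p]. *)
pose I := [set s | exists2 r, ~ p r & iota r *: (s *: (x : M)) = 0].
have idI : ideal I.
  apply/idealP; split=> [|a u v [r pr ru0] [t pt tv0]].
    by exists 1 => //; rewrite scale0r scaler0.
  exists (r * t); first by move=> /pM[].
  rewrite scalerDl scalerDr rmorphM -!scalerA tv0 scaler0 addr0.
  rewrite scalerA [iota r * _]mulrC -scalerA [iota r *: _]scalerA.
  by rewrite [iota r * a]mulrC -scalerA ru0 !scaler0.
have [n [a Ia]] := noethS _ idI.
have Ia_i i : I (a i) by rewrite Ia; exact: ideal_generated_gen.
have /choice[c c_kills] i : exists r, ~ p r /\ iota r *: (a i *: (x : M)) = 0.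
  by have [r ? ?] := Ia_i i; exists r.
pose r0 := \prod_(i < n) c i.
have pr0 : ~ p r0 by apply: prime_ideal_prod => // i; case: (c_kills i).
have r0I s : I s -> iota r0 *: (s *: (x : M)) = 0.
  rewrite Ia => -[b ->]; rewrite scaler_suml scaler_sumr big1 // => i _.
  rewrite /r0 (bigD1 i) //= mulrC rmorphM -!scalerA.
  rewrite [iota (c i) *: _]scalerA [_ * b i]mulrC -scalerA.
  by case: (c_kills i) => _ ->; rewrite !scaler0.
have [|s sP] := @exists_prime_annihilator S M (iota r0 *: (x : M)) noethS.
  by move/pE.
exists (annihilator (s *: (iota r0 *: (x : M)))).
  by split=> //; exists (s *: (iota r0 *: (x : M))).
have [_ s1 _] := sP.
apply/seteqP; split=> r /=; rewrite /annihilator /=.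
  move=> rs0; apply: contrapT => pr; apply: s1.
  rewrite /annihilator /= scale1r scalerA mulrC -scalerA r0I //.
  exists (r * r0); first by move=> /pM[].
  by rewrite rmorphM -scalerA [iota r0 *: _]scalerA [iota r0 * s]mulrC -scalerA.
move=> /pE rx0; by rewrite !scalerA -mulrA mulrC -scalerA rx0 scaler0.
Qed.

(** The finiteness of the support is a genuine hypothesis: a sum with infinite
    support is 0 by convention. *)
Lemma direct_sum_eq0 (I : choiceType) (V : zmodType) (V_ : I -> set V)
    (f : I -> V) :
    internal_direct_sum V_ -> (forall i, V_ i (f i)) ->
    finite_set [set i | f i != 0] -> \sum_(i \in [set: I]) f i = 0 ->
  forall i, f i = 0.
Proof.
move=> [V_closed V_sum] Vf finf f0.
have [g [_ g_uniq]] := V_sum 0.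
have -> : f = g by symmetry; apply: g_uniq.
suff -> : g = (fun=> 0) by [].
apply: g_uniq; split=> [i||].
- by have [/set_mem] := V_closed i.
- by apply: sub_finite_set (finite_set0 I) => i /=; rewrite eqxx.
- by rewrite fsbig1.
Qed.

(** The annihilator of [x] is the intersection of those of its finitely many
    nonzero components. If no component had annihilator inside the prime [p],
    choosing for each an element outside [p] that kills it would give a
    product outside [p] that kills [x]. *)
Lemma Ass_direct_sum (R : comPzRingType) (I : choiceType) (V : lmodType R)
    (V_ : I -> set V) (p : set R) :
    internal_direct_sum V_ ->
    (forall i r v, V_ i v -> V_ i (r *: v)) ->
  Ass [set: V] p -> exists i, Ass (V_ i) p.
Proof.
move=> V_sum V_scale [p_prime [x _ def_p]].
have [f [[Vf finf def_x] _]] := V_sum.2 x.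
have [s def_s] := (finite_seqP _).1 finf.
have fs i : i \notin undup s -> f i = 0.
  rewrite mem_undup; apply: contraNeq => fi0.
  suff : [set` s] i by [].
  by rewrite -def_s.
have sum_seq (g : I -> V) : (forall i, i \notin undup s -> g i = 0) ->
    \sum_(i \in [set: I]) g i = \sum_(i <- undup s) g i.
  move=> g0; rewrite (fsbigE (undup s)) ?undup_uniq //; last by move=> i _; exact: g0.
  by apply: eq_bigl => i; rewrite in_setT.
have px0 r : p r <-> r *: x = 0 by rewrite def_p.
have p_f r i : p r -> r *: f i = 0.
  move/px0=> rx0; apply: (direct_sum_eq0 V_sum (f := fun i => r *: f i)) => [j||].
  - exact: V_scale.
  - apply: sub_finite_set finf => j /=.
    by apply: contra_neq => ->; rewrite scaler0.
  - rewrite sum_seq => [|j js]; last by rewrite fs ?scaler0.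
    by rewrite -scaler_sumr -sum_seq // -def_x.
have [[i f_p]|no_i] := pselect (exists i, forall r, r *: f i = 0 -> p r).
  exists i; split=> //; exists (f i) => //.
  by apply/seteqP; split=> r; [exact: p_f | exact: f_p].
have /choice[c c_kills] i : exists r, ~ p r /\ r *: f i = 0.
  apply: contrapT => no_r; apply: no_i; exists i => r rf0.
  by apply: contrapT => pr; apply: no_r; exists r.
case: (prime_ideal_prod (r := undup s) p_prime (fun i => (c_kills i).1)).
apply/px0.
rewrite def_x (sum_seq f) // scaler_sumr big1_seq // => i /andP[_ is_].
by rewrite (big_rem i) //= mulrC -scalerA (c_kills i).2 scaler0.
Qed.

Theorem theorem5p1 (R S : comPzRingType) (iota : {rmorphism R -> S})
  (S_ : nat -> set S) (M : lmodType S) (M_ : int -> set M)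
  (noethS : noetherian S)
  (gradS : standard_graded iota S_)
  (gradM : graded_module S_ M_) :
  \bigcup_(mu in [set: int])
     Ass (M_ mu : set (restrict_scalars iota M)) =
  [set iota @^-1` P | P in Ass [set: M]].
Proof.
apply/seteqP; split=> [p [mu _ [p_prime [x _ def_p]]]
                      |_ [P [P_prime [x _ def_P]] <-]].
  by apply: Ass_restrict_scalars_lift => //; split=> //; exists x.
have [|mu r y My||mu pMmu] :=
  @Ass_direct_sum R int (restrict_scalars iota M) M_ (iota @^-1` P).
- exact: graded_module_sum gradM.
- rewrite -[mu]add0r; apply: (graded_module_scale gradM) => //.
  by rewrite (standard_graded0 gradS); exists r.
- split; last by exists x => //; rewrite def_P.
  have [/idealP[P0 Plin] P1 PM] := P_prime; split=> [||u v].
  - apply/idealP; split=> [|a u v]; rewrite /preimage /= ?rmorph0 //.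
    by rewrite rmorphD rmorphM; exact: Plin.
  - by rewrite /preimage /= rmorph1.
  - by rewrite /preimage /= rmorphM; exact: PM.
- by exists mu.
Qed.
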